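(* Let $G$ be a finite group and $p$ a prime. Then $G$ has a non-trivial synthetic building of dimension $0$ for the prime $p$ if and only if $G$ has a strongly $p$-embedded subgroup.
   Context: A $G$-simplicial complex is a finite (possibly empty) simplicial complex $\Delta$ with a simplicial action of the finite group $G$ such that the setwise stabilizer of each simplex fixes that simplex pointwise. For $H\le G$, $\Delta^H$ denotes the fixed point subcomplex. Contractible spaces are non-empty. A $G$-simplicial complex $\Delta$ is a synthetic building for $G$ at the prime $p$ if (1) $\Delta^P$ is $N_G(P)$-equivariantly contractible for every non-identity $p$-subgroup $P\le G$, and (2) the stabilizer of every simplex has order divisible by $p$. A synthetic building is non-trivial if it is not $G$-equivariantly homotopy equivalent to a single point. The empty complex does not have dimension $0$. A proper subgroup $H<G$ is strongly $p$-embedded in $G$ if $p$ divides $|H|$ and $p$ does not divide $|H\cap gHg^{-1}|$ whenever $g\in G$, $g\notin H$. *)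

(* Defs.v *)
From HB Require Import structures.
From mathcomp Require Import all_boot all_order all_algebra all_fingroup all_solvable.
From mathcomp Require Import all_classical all_reals all_analysis.

Set Implicit Arguments.
Unset Strict Implicit.
Unset Printing Implicit Defensive.

Import Order.TTheory GRing.Theory Num.Theory.
Import numFieldNormedType.Exports.

Local Open Scope ring_scope.

(* Group actions are the right actions of the library; a left action is turned
   into a right action by inverting the group elements, which changes neither
   the stabilizers and fixed points of subgroups nor the equivariant maps. *)

(* Equivariant homotopy theory of subsets X of a topological space S carrying
   an action of D : {set gT}. Only the elements of the subgroup N of D are
   used, and X is meant to be stable under N, but not necessarily under D. *)
Section EquivariantHomotopy.
Local Open Scope classical_set_scope.
Local Open Scope ring_scope.
Context {gT : finGroupType} (R : realType).
Implicit Types (D N : {set gT}) (S T : topologicalType).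

Definition equivariant_map N D E S T (aS : action D S) (aT : action E T)
    (X : set S) (Y : set T) (f : S -> T) : Prop :=
  [/\ {within X, continuous f},
      (forall x, X x -> Y (f x)) &
      forall g x, g \in N -> X x -> f (aS x g) = aT (f x) g].

(* N acts trivially on the interval [0, 1]. *)
Definition equivariant_homotopic N D E S T (aS : action D S) (aT : action E T)
    (X : set S) (Y : set T) (f0 f1 : S -> T) : Prop :=
  exists h : S * R -> T,
    [/\ {within X `*` `[0, 1], continuous h},
        (forall x t, X x -> 0 <= t <= 1 -> Y (h (x, t))),
        (forall g x t, g \in N -> X x -> 0 <= t <= 1 ->
           h (aS x g, t) = aT (h (x, t)) g),
        (forall x, X x -> h (x, 0) = f0 x) &
        (forall x, X x -> h (x, 1) = f1 x)].

Definition equivariant_homotopy_equivalent N D E S T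
    (aS : action D S) (aT : action E T) (X : set S) (Y : set T) : Prop :=
  exists (f : S -> T) (k : T -> S),
    [/\ equivariant_map N aS aT X Y f,
        equivariant_map N aT aS Y X k,
        equivariant_homotopic N aS aS X X (k \o f) id &
        equivariant_homotopic N aT aT Y Y (f \o k) id].

Definition one_point : topologicalType := discrete_topology unit.

Lemma trivial_is_action D : is_action D (fun (x : one_point) (_ : gT) => x).
Proof. by split=> // g x y. Qed.

Definition trivial_action D : action D one_point :=
  Action (trivial_is_action D).

(* Equivariant homotopy equivalence to a single point; it forces X to be
   nonempty. *)
Definition equivariantly_contractible N D S (aS : action D S) (X : set S) :
    Prop :=
  equivariant_homotopy_equivalent N aS (trivial_action N) X [set: one_point].

End EquivariantHomotopy.

(* A G-simplicial complex is given by its nonempty simplices, every element of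
   [vertex] being a vertex; the empty complex is the one with no vertex. *)
Record gcomplex (gT : finGroupType) (G : {group gT}) := GComplex {
  vertex : finType;
  vertex_act : action G vertex;
  simplices : {set {set vertex}};
  simplices_neq0 : finset.set0 \notin simplices;
  simplices_set1 : forall v : vertex, [set v]%SET \in simplices;
  simplices_sub : forall s t : {set vertex},
    s \in simplices -> t != finset.set0 -> t \subset s -> t \in simplices;
  simplices_act : forall (g : gT) (s : {set vertex}),
    g \in G -> s \in simplices ->
    [set vertex_act v g | v in s]%SET \in simplices;
  (* The setwise stabilizer 'N(s | _) and the pointwise one 'C(s | _) only
     contain elements of the domain G of the action. *)
  simplices_stab : forall s : {set vertex},
    s \in simplices -> ('N(s | vertex_act) \subset 'C(s | vertex_act))%g
}.

(* -1 for the empty complex *)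
Definition complex_dim (gT : finGroupType) (G : {group gT})
    (K : gcomplex G) : int :=
  (\max_(s in simplices K) #|s|)%N%:Z - 1.

(* By simplices_stab, a simplex mapped to itself by a subgroup of G is fixed
   pointwise by it. The subfamily is kept over the same vertex type, so that
   the action of the normalizer need not be restricted. *)
Definition fixed_complex (gT : finGroupType) (G : {group gT})
    (K : gcomplex G) (H : {set gT}) : {set {set vertex K}} :=
  let to := vertex_act K in
  [set s in simplices K | s \subset ('Fix_to(H))%g]%SET.

Section Realization.
Context (R : realType).

(* Barycentric coordinates: a point is a convex combination of the vertices
   whose support is a simplex. *)
Definition realization (V : finType) (F : {set {set V}}) :
    set {ptws V -> R} :=
  [set x : {ptws V -> R} |
    [/\ forall v, 0 <= x v, \sum_v x v = 1 &
        [set v | x v != 0]%SET \in F]]%classic.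

(* The linear extension of the action on the vertices: the coordinate of
   (sum_v x_v v) g at v is the one of x at v g^-1. *)
Definition coord_act (gT : finGroupType) (D : {set gT}) (V : finType)
    (to : action D V) (x : {ptws V -> R}) (g : gT) : {ptws V -> R} :=
  fun v => x (to v g^-1%g).

Lemma coord_is_action (gT : finGroupType) (G : {group gT}) (V : finType)
    (to : action G V) : is_action G (@coord_act gT G V to).
Proof.
split=> [g x y exy|x g h gG hG]; last first.
  by apply/funext => v; rewrite /coord_act invMg actMin // groupV.
apply/funext => v; have := injF_bij (@act_inj _ _ _ to g^-1%g).
by case=> k _ kK; rewrite -(kK v); apply: (congr1 (@^~ (k v)) exy).
Qed.

Definition coord_action (gT : finGroupType) (G : {group gT}) (V : finType)
    (to : action G V) : action G {ptws V -> R} :=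
  Action (coord_is_action to).

Section SyntheticBuilding.
Context (gT : finGroupType) (G : {group gT}) (p : nat).
Implicit Type K : gcomplex G.

Definition synthetic_building K : Prop :=
  (forall P : {group gT}, P \subset G -> (p.-group P)%g -> P :!=: 1%g ->
     equivariantly_contractible R (G :&: 'N(P))%g (coord_action (vertex_act K))
       (realization (fixed_complex K P))) /\
  (forall s, s \in simplices K -> (p %| #|'N(s | vertex_act K)%g|)%N).

Definition nontrivial_complex K : Prop :=
  ~ equivariantly_contractible R G (coord_action (vertex_act K))
      (realization (simplices K)).

End SyntheticBuilding.
End Realization.

(* H :^ g^-1 is g H g^-1. *)
Definition strongly_p_embedded (gT : finGroupType) (G H : {group gT})
    (p : nat) : Prop :=
  [/\ H \proper G, (p %| #|H|)%N &
      forall g, g \in G -> g \notin H -> ~~ (p %| #|(H :&: H :^ g^-1)%g|)%N].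

(* Main.v *)
(** A complex of dimension 0 is a nonempty finite G-set V, and a finite set of
    points is contractible exactly when it is a singleton: V is thus a
    synthetic building if and only if every nontrivial p-subgroup of G fixes
    exactly one point and every point stabilizer has order divisible by p; it
    is nontrivial when it has two points. Two distinct point stabilizers then
    have an intersection of order prime to p, so each of them is strongly
    p-embedded. Conversely, a strongly p-embedded subgroup H contains the
    normalizer of its Sylow p-subgroups, which are therefore Sylow in G; hence
    each p-subgroup of G lies in a conjugate of H, unique if the p-subgroup is
    nontrivial, and H \ G is a synthetic building. *)
Require Import Defs.
From HB Require Import structures.
From mathcomp Require Import all_boot all_order all_algebra all_fingroup all_solvable.
From mathcomp Require Import all_classical all_reals all_analysis.

Set Implicit Arguments.
Unset Strict Implicit.
Unset Printing Implicit Defensive.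

(** * Contractibility of realizations all of whose simplices are vertices *)

Section DiscreteRealization.
Import Order.TTheory GRing.Theory Num.Theory numFieldNormedType.Exports.
Local Open Scope classical_set_scope.
Local Open Scope ring_scope.
Context (R : realType).

(** Extracts from a homotopy the path of a single point [x]: a product neighbourhood of [(x, t)] has
    [x] in its first factor, so its second factor serves for [t]. *)
Lemma within_continuous_slice (S T : topologicalType) (X : set S)
    (I : set R) (h : S * R -> T) (x : S) :
  {within X `*` I, continuous h} -> X x ->
  {within I, continuous (fun t => h (x, t))}.
Proof.
move=> /subspace_continuousP h_cont Xx; apply/subspace_continuousP => t It.
have xt : (X `*` I) (x, t) by [].
apply: cvg_comp (h_cont _ xt) => A.
rewrite /within/= => -[[B C]/= [Bx Ct] BCA].
rewrite /within/= !nbhs_simpl /=.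
apply: filterS Ct => s Cs Is; apply: (BCA (x, s)) => //.
by split=> //; apply: nbhs_singleton.
Qed.

(** Otherwise the intermediate value theorem would yield the value 1/2. *)
Lemma binary_path_const (f : R -> R) :
  {within `[0, 1], continuous f} ->
  (forall t, 0 <= t <= 1 -> f t = 0 \/ f t = 1) -> f 0 = f 1.
Proof.
move=> f_cont f01; apply: contrapT => neq01.
have half_btw : Num.min (f 0) (f 1) <= 2^-1 <= Num.max (f 0) (f 1).
  have lt2 : 2^-1 < 1 :> R by rewrite invf_lt1 ?ltr1n.
  have [] := f01 0; rewrite ?lexx ?ler01 //;
    have [] := f01 1; rewrite ?lexx ?ler01 //.
  - by move=> e1 e0; case: neq01; rewrite e0 e1.
  - by move=> -> ->; rewrite min_l ?max_r ?ler01// invr_ge0 ler0n ltW.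
  - by move=> -> ->; rewrite min_r ?max_l ?ler01// invr_ge0 ler0n ltW.
  - by move=> e1 e0; case: neq01; rewrite e0 e1.
have [c c01 fc] := IVT ler01 f_cont half_btw.
rewrite in_itv/= in c01; have [] := f01 c c01; rewrite fc => /eqP.
  by rewrite invr_eq0 pnatr_eq0.
by rewrite invr_eq1 pnatr_eq1.
Qed.

Definition vertex_point (V : finType) (v : V) : {ptws V -> R} :=
  fun w => (w == v)%:R.

Lemma vertex_point_realization (V : finType) (F : {set {set V}}) v :
  [set v]%SET \in F -> realization F (vertex_point v).
Proof.
move=> Fv; split=> [w||]; first by rewrite /vertex_point ler0n.
  rewrite (bigD1 v)//= /vertex_point eqxx big1 ?addr0// => w /negPf ->; exact: mulr0n.
suff -> : [set w | vertex_point v w != 0]%SET = [set v]%SET by [].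
by apply/finset.setP => w; rewrite !inE /vertex_point pnatr_eq0 eqb0 negbK.
Qed.

(** The support of [x] is a simplex, hence one vertex, and the coordinates sum to 1. *)
Lemma realization_dim0 (V : finType) (F : {set {set V}}) x :
  (forall s, s \in F -> #|s| = 1%N) -> realization F x ->
  exists2 v, [set v]%SET \in F & x = vertex_point v.
Proof.
move=> F1 [x_ge0 x_sum Fx]; have /eqP/cards1P[v xv] := F1 _ Fx.
exists v; first by rewrite -xv.
have x0 w : w != v -> x w = 0.
  move=> wv; apply/eqP; apply: contraNT wv => xw.
  by rewrite -(finset.in_set1 w v) -xv inE.
apply/funext => w; rewrite /vertex_point; have [->|/x0//] := eqVneq.
by rewrite -x_sum (bigD1 v)//= big1 ?addr0.
Qed.

Section Action.
Context (gT : finGroupType) (G : {group gT}) (V : finType) (to : action G V).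

(** The realization is the single point [vertex_point v], so constant maps and constant homotopies
    suffice; they are equivariant because [N] fixes [v]. *)
Lemma contractible_vertex (N : {set gT}) (v : V) :
  N \subset G -> (forall g, g \in N -> to v g = v) ->
  equivariantly_contractible R N (coord_action R to)
    (realization [set [set v]]%SET).
Proof.
move=> sNG Nv; pose X := realization (R := R) [set [set v]]%SET.
have Xv : X (vertex_point v) by apply: vertex_point_realization; rewrite inE.
have XE x : X x -> x = vertex_point v.
  case/realization_dim0 => [s|w]; rewrite inE => /eqP; first by move=> ->; rewrite cards1.
  by move=> /set1_inj ->.
have vN g : g \in N -> coord_act to (vertex_point v) g = vertex_point v.
  move=> Ng; apply/funext => w; rewrite /coord_act /vertex_point; apply: (congr1 (fun b : bool => b%:R : R)).
  have vg : to v g^-1%g = v by rewrite -{1}(Nv g Ng) actKin // (fintype.subsetP sNG).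
  by rewrite -{1}vg (inj_eq (act_inj _ _)).
exists (fun=> tt : one_point), (fun=> vertex_point v); split.
- split=> //; apply: continuous_subspaceT; exact: cst_continuous.
- split=> //; first by apply: continuous_subspaceT; exact: cst_continuous.
  by move=> g x Ng _ /=; rewrite /= vN.
- exists (fun=> vertex_point v); split=> //.
  + by apply: continuous_subspaceT; exact: cst_continuous.
  + by move=> g x t Ng _ _ /=; rewrite vN.
  + by move=> x /XE.
- exists (fun=> tt); split=> //.
    by apply: continuous_subspaceT; exact: cst_continuous.
  by move=> [].
Qed.

(** The homotopy from [k \o f] to the identity joins the point [k tt], a vertex [u], to every
    vertex; as paths stay among the vertices, only [u] can be reached. *)
Lemma contractible_dim0 (N : {set gT}) (F : {set {set V}}) :
  (forall s, s \in F -> #|s| = 1%N) ->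
  equivariantly_contractible R N (coord_action R to) (realization F) ->
  exists v, F = [set [set v]]%SET.
Proof.
move=> F1 [f [k [_ [_ Xk _] [h [h_cont Xh _ h0 h1]] _]]].
have [u Fu ku] := realization_dim0 F1 (Xk tt I).
have vertexE w : [set w]%SET \in F -> w = u.
  move=> Fw; pose x := vertex_point w.
  have Xx : realization F x := vertex_point_realization Fw.
  have pcont := within_continuous_slice h_cont Xx.
  (* Along the path of [x], the coordinate at [w] takes only the values 0 and 1; it ends at 1, and
     would start at 0 if [w] differed from [u]. *)
  have := @binary_path_const (fun t => h (x, t) w).
  have fx : f x = tt by case: (f x).
  rewrite h0 // h1 //= fx ku /x /vertex_point eqxx.
  case: eqP => // _ contra.
  suff /eqP : (0 : R) = 1 by rewrite eq_sym oner_eq0.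
  apply: contra => [|t t01].
    apply: (@within_continuous_comp _ _ _ _ (fun t => h (x, t))
      (fun y : {ptws V -> R} => y w)) => //.
    by move=> y _; exact: (@proj_continuous V (fun=> R) w y).
  have [u' _ ->] := realization_dim0 F1 (Xh _ _ Xx t01).
  by rewrite /vertex_point; case: eqP; [right|left].
exists u; apply/finset.setP => s; rewrite inE.
apply/idP/eqP => [Fs|->//].
have /eqP/cards1P[w sw] := F1 _ Fs; rewrite sw; congr [set _]%SET.
by apply: vertexE; rewrite -sw.
Qed.

End Action.
End DiscreteRealization.

(** * Subgroups of p-power order and strongly p-embedded subgroups *)

Section StronglyEmbedded.
Local Open Scope group_scope.
Context (gT : finGroupType) (p : nat) (p_prime : prime p).
Implicit Types G H P Q : {group gT}.

Lemma dvdn_pgroup_subset H P :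
  p.-group P -> P :!=: 1 -> P \subset H -> p %| #|H|.
Proof.
move=> pP ntP sPH; apply: dvdn_trans (cardSg sPH).
by have [] := pgroup_pdiv pP ntP.
Qed.

Lemma pgroup_of_dvdn H :
  p %| #|H| -> exists P : {group gT}, [/\ p.-group P, P :!=: 1 & P \subset H].
Proof.
move=> pH; have [P sylP] := Sylow_exists p H.
exists P; rewrite (pHall_pgroup sylP) (pHall_sub sylP); split=> //.
by rewrite -rank_gt0 (rank_Sylow sylP) p_rank_gt0 mem_primes p_prime cardG_gt0.
Qed.

(** Since [P] lies in [H :&: H :^ g], p divides the order of this intersection; the embedding
    condition at [g^-1] then forces [g] into [H]. *)
Lemma strongly_embedded_mem G H P g :
  strongly_p_embedded G H p -> p.-group P -> P :!=: 1 -> P \subset H ->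
  g \in G -> P \subset H :^ g -> g \in H.
Proof.
move=> [_ _ H_se] pP ntP sPH gG sPHg; rewrite -groupV; apply/negPn/negP => gH.
have /negP := H_se _ (groupVr gG) gH; rewrite invgK; apply.
by apply: (@dvdn_pgroup_subset (H :&: H :^ g)%G P); rewrite // finset.subsetI sPH.
Qed.

(** A Sylow p-subgroup [Q] of [H] turns out to be Sylow in [G], so Sylow's theorem moves [P] into a
    conjugate of [Q]. *)
Lemma strongly_embedded_sub_conj G H P :
  strongly_p_embedded G H p -> P \subset G -> p.-group P ->
  exists2 g, g \in G & P \subset H :^ g.
Proof.
move=> H_se sPG pP; have [prHG pH _] := H_se.
have sHG := proper_sub prHG.
have [Q sylQ] := Sylow_exists p H.
have ntQ : Q :!=: 1.
  by rewrite -rank_gt0 (rank_Sylow sylQ) p_rank_gt0 mem_primes p_prime cardG_gt0.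
have sQH := pHall_sub sylQ; have pQ := pHall_pgroup sylQ.
(* An element [g] normalizing [Q] gives [Q = Q :^ g], contained in [H :^ g]. *)
have sNH : G :&: 'N(Q) \subset H.
  apply/fintype.subsetP => g /finset.setIP[gG gQ].
  apply: (strongly_embedded_mem H_se pQ) => //.
  by rewrite -(normP gQ) conjSg.
(* A subgroup that is Sylow in its normalizer is Sylow in the whole group. *)
have sylQG : p.-Sylow(G) Q.
  rewrite -Sylow_subnorm; apply: pHall_subl sNH sylQ.
  by rewrite finset.subsetI normG (fintype.subset_trans sQH).
have [g gG sPQg] := Sylow_subJ sylQG sPG pP.
by exists g => //; rewrite (fintype.subset_trans sPQg) // conjSg.
Qed.

End StronglyEmbedded.

(** * Complexes of dimension 0 as nonempty finite G-sets *)

Section DiscreteComplex.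
Import Order.TTheory GRing.Theory Num.Theory numFieldNormedType.Exports.
Local Open Scope group_scope.
Context (R : realType) (gT : finGroupType) (G : {group gT}).
Implicit Types (K : gcomplex G) (P : {group gT}).

Lemma complex_dim0P K :
  complex_dim K = 0%R <->
  (forall s, s \in simplices K -> #|s| = 1%N) /\ (exists v : vertex K, True).
Proof.
rewrite /complex_dim; split=> [/eqP|[K1 [v _]]].
  rewrite subr_eq0 eqz_nat => /eqP maxK; split=> [s Ks|].
    apply/eqP; rewrite eqn_leq -{1}maxK leq_bigmax_cond //= card_gt0.
    by apply: contraNneq (simplices_neq0 K) => <-.
  (* Without vertices the maximum would be 0, giving dimension -1. *)
  apply: contrapT => noV; have := maxK; rewrite big1 // => s _.
  by apply/eqP; rewrite cards_eq0; apply/eqP/finset.setP => v; case: noV; exists v.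
suff -> : \max_(s in simplices K) #|s| = 1%N by rewrite subrr.
apply/eqP; rewrite eqn_leq; apply/andP; split.
  by apply/bigmax_leqP => s /K1 ->.
by rewrite -(cards1 v) leq_bigmax_cond // simplices_set1.
Qed.

Lemma fixed_complex_set1 K P v :
  ([set v]%SET \in fixed_complex K P) = (v \in 'Fix_(vertex_act K)(P)).
Proof. by rewrite inE simplices_set1 finset.sub1set. Qed.

(** Makes nontriviality the case [P = 1] of the criterion on fixed points. *)
Lemma fixed_complex1 K : fixed_complex K 1%G = simplices K.
Proof.
apply/finset.setP => s; rewrite inE andb_idr // => _.
by apply/fintype.subsetP => v _; apply/afixP => g /set1P ->; rewrite act1.
Qed.

Lemma contractible_fixed_complexP K P :
  complex_dim K = 0%R -> P \subset G ->
  equivariantly_contractible R (G :&: 'N(P)) (coord_action R (vertex_act K))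
    (realization (fixed_complex K P)) <->
  exists v, 'Fix_(vertex_act K)(P) = [set v]%SET.
Proof.
move=> /complex_dim0P[K1 _] sPG.
have F1 s : s \in fixed_complex K P -> #|s| = 1%N by rewrite inE => /andP[/K1].
split=> [/(contractible_dim0 F1)[v Fv]|[v fixP]].
  exists v; apply/finset.setP => w; rewrite -fixed_complex_set1 Fv !inE.
  by apply/eqP/eqP => [/set1_inj|->].
have -> : fixed_complex K P = [set [set v]]%SET.
  apply/finset.setP => s; rewrite !inE fixP.
  apply/andP/eqP => [[/K1/eqP/cards1P[w ->]]|->]; last by rewrite simplices_set1.
  by rewrite finset.sub1set inE => /eqP ->.
apply: contractible_vertex => [|g /finset.setIP[gG gP]].
  exact: finset.subsetIl.
(* The normalizer of [P] permutes the vertices fixed by [P], so it fixes the only one: [g * x]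
   equals [x ^ g^-1 * g], where [x ^ g^-1] is in [P]. *)
apply/finset.set1P; rewrite -fixP; apply/afixP => x xP.
have xG := fintype.subsetP sPG x xP.
have /afixP fix_v : v \in 'Fix_(vertex_act K)(P) by rewrite fixP finset.set11.
rewrite -actMin // conjgCV actMin ?groupJ ?groupV // fix_v //.
by rewrite memJ_norm // groupV.
Qed.

(** The trivial group fixes all vertices and has normalizer [G], so contractible means having
    exactly one vertex; dimension 0 provides at least one, [v0]. *)
Lemma nontrivial_complex_dim0P K :
  complex_dim K = 0%R ->
  nontrivial_complex R K <-> exists v w : vertex K, v != w.
Proof.
move=> K0; have [_ [v0 _]] := (complex_dim0P K).1 K0.
have fix1 : 'Fix_(vertex_act K)(1%G) = [set: vertex K]%SET.
  by apply/finset.setP => v; rewrite finset.in_setT; apply/afixP => g /set1P ->; rewrite act1.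
have := contractible_fixed_complexP K0 (sub1G G).
rewrite fixed_complex1 fix1 norm1 finset.setIT /nontrivial_complex => ->.
split=> [ntK|[v [w /eqP vw]] [u Vu]]; last first.
  have inu x : x = u by apply/set1P; rewrite -Vu inE.
  by apply: vw; rewrite (inu v) (inu w).
apply: contrapT => eqV; apply: ntK; exists v0; apply/finset.setP => w.
rewrite !inE; apply/esym; apply: contrapT => /negP wv; apply: eqV.
by exists w, v0.
Qed.

Section OfAction.
Context (V : finType) (to : action G V).

Let points : {set {set V}} := [set [set v]%SET | v in [set: V]]%SET.

Let pointsP s : reflect (exists v, s = [set v]%SET) (s \in points).
Proof. by apply: (iffP imsetP) => [[v _ ->]|[v ->]]; exists v; rewrite ?inE. Qed.

(** Kept transparent so that its vertices and action reduce to [V] and [to]. *)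
Definition discrete_complex : gcomplex G.
Proof.
apply: (@GComplex gT G V to points).
- by apply/pointsP => -[v /finset.setP/(_ v)]; rewrite !inE eqxx.
- by move=> v; apply/pointsP; exists v.
- move=> s t /pointsP[v ->] nt; rewrite subset1 (negPf nt) orbF => /eqP ->.
  by apply/pointsP; exists v.
- move=> g s gG /pointsP[v ->]; rewrite imset_set1; apply/pointsP.
  by exists (to v g).
- by move=> s /pointsP[v ->]; rewrite astabs_set1.
Defined.

Lemma complex_dim_discrete : V -> complex_dim discrete_complex = 0%R.
Proof.
move=> v; apply/complex_dim0P; split; last by exists v.
by move=> s /pointsP[w ->]; rewrite cards1.
Qed.

End OfAction.

Lemma synthetic_building_dim0P K (p : nat) :
  complex_dim K = 0%R ->
  synthetic_building R p K <->
  (forall P, P \subset G -> p.-group P -> P :!=: 1 ->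
     exists v, 'Fix_(vertex_act K)(P) = [set v]%SET) /\
  (forall v, p %| #|'C[v | vertex_act K]|).
Proof.
move=> K0; have [K1 _] := (complex_dim0P K).1 K0.
split=> -[contr stab]; split.
- by move=> P sPG pP ntP; apply/contractible_fixed_complexP => //; apply: contr.
- by move=> v; rewrite -astabs_set1; apply/stab/simplices_set1.
- by move=> P sPG pP ntP; apply/contractible_fixed_complexP => //; apply: contr.
- by move=> s /K1/eqP/cards1P[v ->]; rewrite astabs_set1.
Qed.

End DiscreteComplex.

(** * Right translation on the right cosets of a subgroup *)

Section CosetAction.
Local Open Scope group_scope.
Context (gT : finGroupType) (G H : {group gT}).

(** A subtype, since every element of the vertex type of a [gcomplex] is a vertex. *)
Definition right_coset := {x : {set gT} | x \in rcosets H G}.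

Lemma rcosets_subact_dom :
  G \subset subact_dom (fun x : {set gT} => x \in rcosets H G) 'Rs.
Proof.
apply/fintype.subsetP => g gG; rewrite !inE /=.
apply/fintype.subsetP => x; rewrite !inE => /rcosetsP[a aG ->] /=.
by rewrite rcosetE -rcosetM; apply/rcosetsP; exists (a * g); rewrite ?groupM.
Qed.

Definition coset_action : action G right_coset :=
  ('Rs^? \ rcosets_subact_dom)%act.

Lemma val_coset_action (x : right_coset) g :
  g \in G -> val (coset_action x g) = val x :* g.
Proof.
move=> gG; rewrite /= val_subact /=.
by rewrite (fintype.subsetP rcosets_subact_dom) //= rcosetE.
Qed.

(** For [g] in [G], [H :* (a * g) = H :* a] means that [a * g * a^-1] is in [H]; outside [G] there
    is nothing on either side. *)
Lemma astab1_coset_action (x : right_coset) a :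
  H \subset G -> a \in G -> val x = H :* a -> 'C[x | coset_action] = H :^ a.
Proof.
move=> sHG aG xE; apply/finset.setP => g.
rewrite finset.in_setI; case: (boolP (g \in G)) => [gG|gG]; last first.
  apply/esym/negbTE; apply: contraNN gG => /imsetP[h hH ->].
  by rewrite groupJ // (fintype.subsetP sHG).
rewrite /= inE finset.sub1set inE.
rewrite -val_eqE val_coset_action // xE -rcosetM.
by rewrite (sameP eqP rcoset_eqP) mem_rcoset mem_conjg conjgE invgK mulgA.
Qed.
End CosetAction.

(** * From point stabilizers to strongly p-embedded subgroups and back *)

Theorem corollary5p3 (R : realType) (gT : finGroupType) (G : {group gT})
    (p : nat) (p_prime : prime p) :
  (exists K : gcomplex G,
     [/\ synthetic_building R p K, nontrivial_complex R K &
         complex_dim K = 0%R]) <->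
  (exists H : {group gT}, strongly_p_embedded G H p).
Proof.
split=> [[K [synK ntK K0]]|[H H_se]].
  have [fixP stab] := (synthetic_building_dim0P R p K0).1 synK.
  have [v [w /eqP vw]] := (nontrivial_complex_dim0P R K0).1 ntK.
  pose to := vertex_act K.
  have fixed_uniq (P : {group gT}) x y : P \subset G -> (p.-group P)%g -> (P :!=: 1)%g ->
      (P \subset 'C[x | to])%g -> (P \subset 'C[y | to])%g -> x = y.
    move=> sPG pP ntP; rewrite !sub_astab1_in //.
    have [z ->] := fixP P sPG pP ntP.
    by rewrite !finset.in_set1 => /eqP -> /eqP ->.
  have sCG x : ('C[x | to] \subset G)%g by exact: finset.subsetIl.
  exists 'C[v | to]%G; split=> [||g gG gC]; last 1 first.
  - apply/negP => /(pgroup_of_dvdn p_prime)[P [pP ntP]].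
    rewrite finset.subsetI => /andP[sPC sPCg]; move/negP: gC; apply.
    (* The conjugate by [g^-1] of the stabilizer of [v] is the stabilizer of [to v g^-1]; [P] fixes
       both points, so they coincide. *)
    have : g^-1%g \in 'C[v | to]%g.
      rewrite 2!inE groupV gG finset.sub1set inE; apply/eqP.
      apply: (fixed_uniq P) => //; first exact: fintype.subset_trans sPC (sCG v).
      by rewrite astab1_act_in ?groupV.
    by rewrite groupV.
  (* If [G] fixed [v], a nontrivial p-subgroup of the stabilizer of [w] would fix both [v] and
     [w]. *)
  - rewrite properE sCG; apply/negP => sGC; apply: vw.
    have [P [pP ntP sPC]] := pgroup_of_dvdn (H := 'C[w | to]%G) p_prime (stab w).
    have sPG := fintype.subset_trans sPC (sCG w).
    by apply: (fixed_uniq P) => //; apply: fintype.subset_trans sGC.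
  - exact: stab.
have [prHG pH _] := H_se; have sHG := proper_sub prHG.
pose to := coset_action G H.
have cosetP (x : right_coset G H) : exists2 a, a \in G & val x = (H :* a)%g.
  exact/rcosetsP/(valP x).
have coset_ex a : a \in G -> {x : right_coset G H | val x = (H :* a)%g}.
  move=> aG; have Ha : (H :* a)%g \in rcosets H G by apply/rcosetsP; exists a.
  by exists (exist _ (H :* a)%g Ha).
have [x1 x1E] := coset_ex 1%g (group1 G).
have K0 : complex_dim (discrete_complex to) = 0%R := complex_dim_discrete to x1.
exists (discrete_complex to); split=> //.
  apply/(synthetic_building_dim0P R p K0); split=> [P sPG pP ntP|x] /=; last first.
    have [a aG xE] := cosetP x.
    by rewrite (astab1_coset_action sHG aG xE) cardJg.
  have [a aG sPHa] := strongly_embedded_sub_conj p_prime H_se sPG pP.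
  have [x xE] := coset_ex a aG.
  exists x; apply/finset.setP => y; rewrite finset.in_set1 -sub_astab1_in //.
  have [b bG yE] := cosetP y; rewrite (astab1_coset_action sHG bG yE).
  apply/idP/eqP => [sPHb|yx].
    apply/val_inj; rewrite /= yE xE; apply/rcoset_eqP; rewrite mem_rcoset.
    (* With [P] in both [H :^ a] and [H :^ b], its conjugate by [a^-1] lies in [H] and in
       [H :^ (b * a^-1)], so [b * a^-1] is in [H] and the two cosets agree. *)
    apply: (@strongly_embedded_mem _ p G H (P :^ a^-1)%G) => //.
    - by rewrite pgroupJ.
    - by rewrite -subG1 sub_conjg invgK conjs1g subG1.
    - by rewrite sub_conjg invgK.
    - by rewrite groupM ?groupV.
    - by rewrite conjsgM conjSg.
  by rewrite -(astab1_coset_action sHG bG yE) yx (astab1_coset_action sHG aG xE).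
apply/(nontrivial_complex_dim0P R K0).
(* An element of [G] outside [H] yields a coset other than [H] itself. *)
have /properP[_ [g gG gH]] := prHG; have [xg xgE] := coset_ex g gG.
exists x1, xg; apply: contraNneq gH => /(congr1 val).
rewrite /= x1E xgE rcoset1 => ->; exact: rcoset_refl.
Qed.
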